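(* For every $n\in\mathbb{N}$, there is a family $\mathcal{M}_n$ of metric spaces, each with $O(n)$ points, aspect ratio $\Phi=4^n$, and doubling dimension bounded by a universal constant, where each metric $(X,d_X)\in\mathcal{M}_n$ is the shortest path metric of a series-parallel (in particular, planar) graph, such that every stochastic online embedding into $\ell_2$ has expected distortion $\Omega(\sqrt{\log\Phi})=\Omega(\sqrt{n})$ on $\mathcal{M}_n$ (i.e., for every online embedding algorithm into $\ell_2$, possibly randomized, some metric in $\mathcal{M}_n$ with some arrival order of its points forces expected distortion $\Omega(\sqrt{n})$).
   Context: An online embedding of a sequence $x_1,\dots,x_k$ of points of a metric space $(X,d_X)$ into a metric space $(Y,d_Y)$ is a sequence of maps $f_1,\dots,f_k$, $f_i:\{x_1,\dots,x_i\}\to Y$, with $f_{i+1}$ extending $f_i$, where $f_i$ may depend only on $x_1,\dots,x_i$. It is dominating if $d_Y(f_k(x_i),f_k(x_j))\ge d_X(x_i,x_j)$ for all $i,j$. A stochastic online embedding is a distribution $\mathcal{D}$ over dominating online embeddings (produced by a randomized online algorithm; the point sequence is fixed in advance but unknown to the algorithm); it has expected distortion $t$ if for all $i,j$, $\mathbb{E}_{f\sim\mathcal{D}}[d_Y(f_k(x_i),f_k(x_j))]\le t\cdot d_X(x_i,x_j)$. The aspect ratio of a finite metric is the ratio of its maximum to its minimum nonzero distance. A metric space has doubling dimension $\mathrm{ddim}$ if every ball of radius $2r$ can be covered by $2^{\mathrm{ddim}}$ balls of radius $r$. *)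

(* Defs.v *)
From HB Require Import structures.
From mathcomp Require Import all_boot all_order all_algebra.
From mathcomp Require Import all_classical all_reals all_analysis.

Set Implicit Arguments.
Unset Strict Implicit.
Unset Printing Implicit Defensive.

Import Order.TTheory GRing.Theory Num.Theory.
Import numFieldNormedType.Exports.

Local Open Scope ring_scope.

#[short(type="finMetricType")]
HB.structure Definition FinMetric (R : numDomainType) :=
  { T of Finite T & Metric R T }.

Definition diameter (R : realType) (X : finMetricType R) : R :=
  \big[Order.max/0]_(p : X * X) mdist p.1 p.2.

(* The default value [diameter X] bounds every distance, so it does not affect
   the minimum as soon as X has two points. *)
Definition min_distance (R : realType) (X : finMetricType R) : R :=
  \big[Order.min/diameter X]_(p : X * X | mdist p.1 p.2 != 0) mdist p.1 p.2.

Definition aspect_ratio (R : realType) (X : finMetricType R) : R :=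
  diameter X / min_distance X.

Definition ddim_le (R : realType) (X : finMetricType R) (D : nat) : Prop :=
  forall (x : X) (r : R), 0 < r ->
    exists2 S : {set X}, (#|S| <= 2 ^ D)%N
      & forall y, ball x (2 * r) y -> exists2 z, z \in S & ball z r y.

(* A finite simple graph on V is given by the set E of its edges, an edge being
   a set of two vertices; [finset.cover E] is the set of vertices incident to an
   edge.  [series_parallel E s t]: E is the edge set of a two-terminal
   series-parallel graph with terminals s and t. *)
Inductive series_parallel (V : finType) : {set {set V}} -> V -> V -> Prop :=
| SP_edge (s t : V) of s != t :
    series_parallel [set [set s; t]%SET]%SET s t
| SP_series (E F : {set {set V}}) (s m t : V)
    of series_parallel E s m & series_parallel F m t
    & (finset.cover E :&: finset.cover F)%SET = [set m]%SET :
    series_parallel (E :|: F)%SET s t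
| SP_parallel (E F : {set {set V}}) (s t : V)
    of series_parallel E s t & series_parallel F s t
    & (finset.cover E :&: finset.cover F)%SET = [set s; t]%SET
    & [disjoint E & F] :
    series_parallel (E :|: F)%SET s t.

Definition series_parallel_graph (V : finType) (E : {set {set V}}) : Prop :=
  finset.cover E = [set: V]%SET /\ exists s t, series_parallel E s t.

Definition edge_rel (V : finType) (E : {set {set V}}) : rel V :=
  fun u v => [set u; v]%SET \in E.

Fixpoint walk_length (R : realType) (V : finType) (w : {set V} -> R)
    (u : V) (p : seq V) : R :=
  if p is v :: q then w [set u; v]%SET + walk_length w v q else 0.

Definition shortest_path_metric (R : realType) (X : finMetricType R)
    (E : {set {set X}}) (w : {set X} -> R) : Prop :=
  forall x y : X,
    (exists p, [/\ path (edge_rel E) x p, last x p = y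
                 & mdist x y = walk_length w x p]) /\
    (forall p, path (edge_rel E) x p -> last x p = y ->
       mdist x y <= walk_length w x p).

Lemma lee12 (R : realType) : (1 <= 2%:E :> \bar R)%E.
Proof. by rewrite lee_fin ler1n. Qed.

Notation l2 R := (LfunType (@counting nat R) (lee12 R)).

Definition l2dist (R : realType) (x y : l2 R) : \bar R :=
  'N[@counting nat R]_(2%:E)[EFin \o (x \- y)%R]%E.

(* A deterministic online algorithm: upon arrival of the point number i
   (counting from 0), it sees the distances among the points 0, ..., i and
   returns the image of the last of them, irrevocably. *)
Definition online_algorithm (R : realType) : Type :=
  forall i : nat, 'M[R]_i.+1 -> l2 R.

Definition prefix_distances (R : realType) (X : metricType R) (k : nat)
    (x : 'I_k -> X) (i : 'I_k) : 'M[R]_i.+1 :=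
  \matrix_(a, b) mdist (x (widen_ord (ltn_ord i) a))
                       (x (widen_ord (ltn_ord i) b)).

(* The last map of the online embedding of x produced by the algorithm; the
   earlier ones are its restrictions to the prefixes of x. *)
Definition online_embedding (R : realType) (A : online_algorithm R)
    (X : metricType R) (k : nat) (x : 'I_k -> X) (i : 'I_k) : l2 R :=
  A i (prefix_distances x i).

Definition dominating (R : realType) (X : metricType R) (k : nat)
    (x : 'I_k -> X) (f : 'I_k -> l2 R) : Prop :=
  forall i j, ((mdist (x i) (x j))%:E <= l2dist (f i) (f j))%E.

(* A randomized algorithm is a random deterministic algorithm, A w being the
   one run on the random seed w.  Coordinatewise measurability is measurability
   for the Borel sets of l2. *)
Definition stochastic_dominating (R : realType) (d : measure_display)
    (Omega : measurableType d) (P : probability Omega R)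
    (A : Omega -> online_algorithm R)
    (X : metricType R) (k : nat) (x : 'I_k -> X) : Prop :=
  (forall (i : 'I_k) (m : nat),
     measurable_fun [set: Omega]%classic
       (fun w => online_embedding (A w) x i m : R)) /\
  {ae P, forall w, dominating x (online_embedding (A w) x)}.

Definition expected_distortion (R : realType) (d : measure_display)
    (Omega : measurableType d) (P : probability Omega R)
    (A : Omega -> online_algorithm R)
    (X : metricType R) (k : nat) (x : 'I_k -> X) (t : R) : Prop :=
  forall i j : 'I_k,
    (\int[P]_w l2dist (online_embedding (A w) x i) (online_embedding (A w) x j)
       <= (t * mdist (x i) (x j))%:E)%E.

(* Main.v *)
From HB Require Import structures.
Require Import Defs.
From mathcomp Require Import all_boot all_order all_algebra.
From mathcomp Require Import all_classical all_reals all_analysis.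
From mathcomp Require Import measurable_realfun zify lra.

(* The metrics are those of diamond graphs in which only one edge is refined at
   each of m = 2n steps: an edge st of length 2L is replaced by a 4-cycle s, a,
   t, b with sides of length L, and the adversary picks one of the four sides as
   the next edge.  At each scale the ball B(x, 2r) then meets boundedly many
   points that are r-separated, which bounds the doubling dimension.

   Only first moments of the embedded distances are controlled, so the usual
   argument with squared distances does not apply.  Instead, put
   N(xy) = sqrt (K^2 + (|f x - f y| / d(x,y))^2) with K = sqrt (m + 1), the norm of
   a vector to which a coordinate K has been added.  The parallelogram law, the
   Cauchy-Schwarz inequality and |f a - f b| >= 2L show that the average of N over
   the four sides is at least N(st) + (2 - N(st)/K) / (40 K).  This bound is affine
   in N(st), so it survives expectations: choosing each time a side of maximal
   expected N, the expectation reaches K + m / (80 K) after m steps.  As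
   N <= K + |f x - f y| / d(x,y), the last edge has expected stretch at least
   m / (80 K), which is of order sqrt n. *)

Set Implicit Arguments.
Unset Strict Implicit.
Unset Printing Implicit Defensive.

Import Order.TTheory GRing.Theory Num.Theory.
Import numFieldNormedType.Exports.

Local Open Scope ring_scope.

(** * Distances in the diamond graph, on vertex numbers *)

Section VertexDistance.
Local Open Scope nat_scope.

(* A sequence [l] of choices encodes the points presented in [size l] steps, the
   most recent choice being the head of [l].  The points are numbered in their
   order of arrival.  A step replaces the current edge [ends l] = {s, t} by the
   4-cycle s, N, t, N + 1 where N = [npoints l]; the choice [c] selects the next
   edge, joining s or t, according to [c.1], to N or N + 1, according to
   [c.2]. *)
Definition choice_seq := seq (bool * bool).

Definition npoints (l : choice_seq) : nat := (size l).*2.+2.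

Fixpoint ends (l : choice_seq) : nat * nat :=
  if l is c :: l' then
    (if c.1 then (ends l').1 else (ends l').2, npoints l' + c.2)
  else (0, 1).

Definition edge_len (m : nat) (l : choice_seq) : nat := 2 ^ (m - size l).

(* The distance after the steps of [l], the initial edge having length [2 ^ m];
   it does not depend on the head of [l], as required of an online instance. *)
Fixpoint vdist (m : nat) (l : choice_seq) (x y : nat) : nat :=
  if l is c :: l' then
    if (x < npoints l') && (y < npoints l') then vdist m l' x y
    else if x == y then 0
    else if (x < npoints l') || (y < npoints l') then
      edge_len m l + minn (vdist m l' (ends l').1 (minn x y))
                          (vdist m l' (ends l').2 (minn x y))
    else (edge_len m l).*2
  else if x == y then 0 else 2 ^ m.

Lemma edge_len_gt0 m l : 0 < edge_len m l.
Proof. by rewrite expn_gt0. Qed.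

Lemma edge_len_cons m c l : size l < m -> edge_len m l = (edge_len m (c :: l)).*2.
Proof.
by move=> lm; rewrite /edge_len /= -mul2n -expnS; congr (2 ^ _); lia.
Qed.

Lemma leq_edge_len_cons m c l : edge_len m (c :: l) <= edge_len m l.
Proof. by rewrite leq_exp2l //=; lia. Qed.

Lemma npoints_cons c l : npoints (c :: l) = (npoints l).+2.
Proof. by []. Qed.

Lemma ends_cons1 c l :
  (ends (c :: l)).1 = if c.1 then (ends l).1 else (ends l).2.
Proof. by []. Qed.

Lemma ends_cons2 c l : (ends (c :: l)).2 = npoints l + c.2.
Proof. by []. Qed.

Lemma ends_lt l : (ends l).1 < npoints l /\ (ends l).2 < npoints l.
Proof.
elim: l => [//|c l [IH1 IH2]]; rewrite npoints_cons /=.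
by split; case: c => [[] []] /=; lia.
Qed.

Lemma ends_neq l : (ends l).1 != (ends l).2.
Proof.
case: l => [//|c l] /=; have [] := ends_lt l.
by case: c => [[] []] /=; lia.
Qed.

Lemma vdistC m l x y : vdist m l x y = vdist m l y x.
Proof.
elim: l x y => [|c l IH] x y /=; first by rewrite eq_sym.
by rewrite andbC IH (eq_sym y x) (orbC (y < _)) (minnC y x).
Qed.

Lemma vdistxx m l x : vdist m l x x = 0.
Proof. by elim: l x => [|c l IH] x /=; rewrite ?eqxx // IH; case: ifP. Qed.

Section Step.
Variables (m : nat) (c : bool * bool) (l : choice_seq).
Local Notation N := (npoints l).

Lemma vdist_old x y : x < N -> y < N -> vdist m (c :: l) x y = vdist m l x y.
Proof. by move=> xN yN /=; rewrite xN yN. Qed.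

Lemma vdist_new x y : N <= x -> y < N -> vdist m (c :: l) x y =
  edge_len m (c :: l) + minn (vdist m l (ends l).1 y) (vdist m l (ends l).2 y).
Proof.
move=> xN yN; rewrite [LHS]/=.
have -> : (x == y) = false by apply/eqP; lia.
have -> : minn x y = y by lia.
by rewrite ltnNge xN yN.
Qed.

Lemma vdist_new2 x y : N <= x -> N <= y -> x != y ->
  vdist m (c :: l) x y = (edge_len m (c :: l)).*2.
Proof. by move=> xN yN /negPf xy; rewrite [LHS]/= (ltnNge x N) (ltnNge y N) xN yN xy. Qed.

End Step.

(** Online consistency: the distance matrix shown to the algorithm when a point arrives does not
    depend on later choices. *)
Lemma vdist_cat m l' l x y : x < npoints l -> y < npoints l ->
  vdist m (l' ++ l) x y = vdist m l x y.
Proof.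
elim: l' => [//|c l' IH] xl yl; rewrite cat_cons -IH // vdist_old //.
  by apply: leq_trans xl _; rewrite /npoints size_cat; lia.
by apply: leq_trans yl _; rewrite /npoints size_cat; lia.
Qed.

Lemma edge_len_le_vdist m l x y : x != y -> edge_len m l <= vdist m l x y.
Proof.
elim: l x y => [|c l IH] x y xy; first by rewrite /= (negPf xy) /edge_len subn0.
have [xN|xN] := ltnP x (npoints l); have [yN|yN] := ltnP y (npoints l).
- by rewrite vdist_old //; apply: leq_trans (leq_edge_len_cons _ _ _) (IH _ _ xy).
- by rewrite vdistC vdist_new // leq_addr.
- by rewrite vdist_new // leq_addr.
- by rewrite vdist_new2 // -addnn leq_addr.
Qed.

Lemma vdist_new_ends m c l x : npoints l <= x ->
  vdist m (c :: l) x (ends l).1 = edge_len m (c :: l) /\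
  vdist m (c :: l) x (ends l).2 = edge_len m (c :: l).
Proof.
have [s_lt t_lt] := ends_lt l => xN.
by rewrite !vdist_new // !vdistxx minn0 min0n addn0.
Qed.

Lemma vdist_ends m l : size l <= m -> vdist m l (ends l).1 (ends l).2 = edge_len m l.
Proof.
case: l => [|c l] lm; first by rewrite /edge_len subn0.
have [s_lt t_lt] := ends_lt l.
rewrite [ends _]/= [_.2]/= vdistC.
have /(vdist_new_ends m c)[e1 e2] : npoints l <= npoints l + c.2 by rewrite leq_addr.
by rewrite /=; case: c.1.
Qed.

(** A new vertex is joined to the old ones only through s and t, at distance L from each. Since d(s,
    t) = 2L, a detour from s to t through it is no shortcut, so old distances remain consistent. *)
Lemma vdist_triangle m l x y z : size l <= m ->
  vdist m l x z <= vdist m l x y + vdist m l y z.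
Proof.
elim: l x y z => [|c l IH] x y z lm.
  rewrite /=; case: (eqVneq x z) => // xz.
  by case: (eqVneq x y) => [<-|_]; rewrite ?(negPf xz) ?leq_addr.
have {}IH u v w := IH u v w (ltnW lm).
have st := vdist_ends (ltnW lm); rewrite (edge_len_cons c lm) in st.
have [->|xy] := eqVneq x y; first by rewrite vdistxx.
have [->|yz] := eqVneq y z; first by rewrite vdistxx addn0.
have [->|xz] := eqVneq x z; first by rewrite vdistxx.
set s := (ends l).1 in st; set t := (ends l).2 in st.
have [xN|xN] := ltnP x (npoints l); have [yN|yN] := ltnP y (npoints l);
  have [zN|zN] := ltnP z (npoints l).
- by rewrite !vdist_old.
- rewrite (vdist_old _ _ xN yN) (vdistC _ _ x z) (vdistC _ _ y z).
  rewrite (vdist_new _ _ zN xN) (vdist_new _ _ zN yN).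
  rewrite -/s -/t; have := IH s y x; have := IH t y x; rewrite (vdistC _ _ y x); lia.
- rewrite (vdist_old _ _ xN zN) (vdistC _ _ x y).
  rewrite (vdist_new _ _ yN xN) (vdist_new _ _ yN zN) -/s -/t.
  have := IH x s z; have := IH x t z; have := IH x s t; have := IH s t z.
  have := IH x t s; have := IH t s z.
  by rewrite (vdistC _ _ x s) (vdistC _ _ x t) (vdistC _ _ t s); lia.
- rewrite (vdistC _ _ x z) (vdistC _ _ x y).
  rewrite (vdist_new _ _ zN xN) (vdist_new _ _ yN xN) (vdist_new2 _ _ yN zN) //; lia.
- rewrite (vdist_new _ _ xN yN) (vdist_new _ _ xN zN) -/s -/t (vdist_old _ _ yN zN).
  have := IH s y z; have := IH t y z; lia.
- rewrite (vdist_new2 _ _ xN zN) // (vdist_new _ _ xN yN) (vdistC _ _ y z).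
  rewrite (vdist_new _ _ zN yN); lia.
- rewrite (vdist_new _ _ xN zN) (vdist_new _ _ yN zN) (vdist_new2 _ _ xN yN) //; lia.
- rewrite (vdist_new2 _ _ xN yN) // (vdist_new2 _ _ xN zN) //; lia.
Qed.

(** The first conjunct strengthens the induction: with edge length 2L, the smaller of the distances
    from a point to the two ends is at most 2 ^ m - L, so a new vertex, L further away, stays within
    2 ^ m. *)
Lemma vdist_le m l : size l <= m ->
  (forall x, x < npoints l ->
     vdist m l (ends l).1 x + vdist m l (ends l).2 x + edge_len m l <= (2 ^ m).*2) /\
  forall x y, vdist m l x y <= 2 ^ m.
Proof.
elim: l => [|c l IH] lm.
  split=> [x|x y]; last by rewrite /=; case: eqP.
  by rewrite /edge_len subn0; case: x => [|[|//]] _ /=; move: (2 ^ m) => L; lia.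
have [{IH}IH1 IH2] := IH (ltnW lm).
have [s_lt t_lt] := ends_lt l.
have lenE := edge_len_cons c lm; have len0 := edge_len_gt0 m (c :: l).
have len_le : edge_len m l <= 2 ^ m by rewrite /edge_len leq_exp2l //; lia.
split=> [x|x].
  rewrite ends_cons1 ends_cons2 => x_lt; set u := if c.1 then _ else _.
  have uE : u = (ends l).1 \/ u = (ends l).2 by rewrite /u; case: c.1; [left|right].
  have uN : u < npoints l by case: uE => ->.
  have pN : npoints l <= npoints l + c.2 by rewrite leq_addr.
  have [xN|xN] := ltnP x (npoints l).
    rewrite vdist_old // vdist_new //; have := IH1 x xN; case: uE => ->; lia.
  rewrite vdistC vdist_new //.
  have -> : minn (vdist m l (ends l).1 u) (vdist m l (ends l).2 u) = 0.
    by case: uE => ->; rewrite vdistxx ?minn0 ?min0n.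
  have : vdist m (c :: l) (npoints l + c.2) x <= (edge_len m (c :: l)).*2.
    by have [->|px] := eqVneq (npoints l + c.2) x; rewrite ?vdistxx ?vdist_new2.
  lia.
move=> y; have [xN|xN] := ltnP x (npoints l); have [yN|yN] := ltnP y (npoints l).
- by rewrite vdist_old.
- rewrite vdistC vdist_new //; have := IH1 x xN; lia.
- rewrite vdist_new //; have := IH1 y yN; lia.
- have [->|xy] := eqVneq x y; first by rewrite vdistxx.
  by rewrite vdist_new2 //; lia.
Qed.

(** A geometric series: each step moves the new vertices away by at most the halved edge length. The
    first conjunct records that the distance covered plus the remaining edge length never exceeds
    [edge_len m l]. *)
Lemma vdist_later m l' l : size (l' ++ l) <= m ->
  minn (vdist m (l' ++ l) (ends (l' ++ l)).1 (ends l).1)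
       (vdist m (l' ++ l) (ends (l' ++ l)).2 (ends l).1)
    + edge_len m (l' ++ l) <= edge_len m l /\
  forall x, npoints l <= x -> x < npoints (l' ++ l) ->
   vdist m (l' ++ l) x (ends l).1 <= edge_len m l.
Proof.
elim: l' => [|c l' IH] lm.
  split; first by rewrite /= vdistxx min0n.
  by move=> x; rewrite cat0s => h1 h2; lia.
have [{IH}IH1 IH2] := IH (ltnW lm).
have [s_lt _] := ends_lt l.
have sN : (ends l).1 < npoints (l' ++ l).
  by apply: leq_trans s_lt _; rewrite /npoints size_cat; lia.
have lenE : edge_len m (l' ++ l) = (edge_len m (c :: (l' ++ l))).*2.
  exact: edge_len_cons.
rewrite cat_cons; split.
  rewrite ends_cons1 ends_cons2 (vdist_new _ _ (leq_addr _ _)) //.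
  lia.
move=> x xl; rewrite npoints_cons => xlt.
have [xN|xN] := ltnP x (npoints (l' ++ l)); first by rewrite vdist_old // IH2.
rewrite vdist_new //; lia.
Qed.

End VertexDistance.

(* The vertices form a type in Set: the universe of ['I_n] is that of [set],
   whereas the carrier of a [finMetricType] must be strictly below the latter
   for the type [set (finMetricType R)] to make sense. *)
Record vertex (n : nat) : Set :=
  Vertex { vertex_val :> nat; vertex_lt : (vertex_val < n)%N }.

HB.instance Definition _ n := [isSub for @vertex_val n].
HB.instance Definition _ n := [Countable of vertex n by <:].

Definition ord_of_vertex n (v : vertex n) : 'I_n := Ordinal (vertex_lt v).

Definition vertex_of_ord n (i : 'I_n) : vertex n := Vertex (ltn_ord i).

Lemma ord_of_vertexK n : cancel (@ord_of_vertex n) (@vertex_of_ord n).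
Proof. by move=> v; exact/val_inj. Qed.

Lemma vertex_of_ordK n : cancel (@vertex_of_ord n) (@ord_of_vertex n).
Proof. by move=> i; exact/val_inj. Qed.

HB.instance Definition _ n : fintype.isFinite (vertex n) :=
  CanIsFinite (@ord_of_vertexK n).

Lemma card_vertex n : #|{: vertex n}| = n.
Proof.
rewrite -[RHS]card_ord; apply: (@bij_eq_card _ _ (@ord_of_vertex n)).
by exists (@vertex_of_ord n); [exact: ord_of_vertexK|exact: vertex_of_ordK].
Qed.

(** * The metric space of a choice sequence, its aspect ratio and its doubling dimension *)

Definition space (R : realType) (l : choice_seq) : Set := vertex (npoints l).

HB.instance Definition _ (R : realType) (l : choice_seq) :=
  Finite.on (space R l).

Section SpaceMetric.
Variables (R : realType) (l : choice_seq).

Definition space_dist (x y : space R l) : R := (vdist (size l) l x y)%:R.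

Lemma space_distxx x : space_dist x x = 0.
Proof. by rewrite /space_dist vdistxx. Qed.

Lemma space_dist_eq0 x y : space_dist x y = 0 -> x = y.
Proof.
move=> /eqP; rewrite pnatr_eq0 => /eqP dxy; apply/val_inj/eqP => /=.
apply/negPn/negP => /(edge_len_le_vdist (size l) l); rewrite dxy.
by rewrite leqNgt edge_len_gt0.
Qed.

Lemma space_distC x y : space_dist x y = space_dist y x.
Proof. by rewrite /space_dist vdistC. Qed.

Lemma space_dist_triangle y x z :
  space_dist x z <= space_dist x y + space_dist y z.
Proof. by rewrite -natrD ler_nat vdist_triangle. Qed.

HB.instance Definition _ := isMetric.Build R (space R l)
  space_distxx space_dist_eq0 space_distC space_dist_triangle.

End SpaceMetric.

Definition point_space (R : realType) (l : choice_seq) : finMetricType R :=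
  space R l.

Section SpaceProperties.
Variables (R : realType) (l : choice_seq).
Local Notation X := (point_space R l).

Lemma mdist_space (x y : X) :
  mdist x y = (vdist (size l) l (vertex_val x) (vertex_val y))%:R :> R.
Proof. by []. Qed.

Lemma ball_space (x : X) (r : R) (y : X) : ball x r y = (mdist x y < r) :> Prop.
Proof. by rewrite ballEmdist. Qed.

Lemma card_space : #|X| = npoints l.
Proof. exact: card_vertex. Qed.

Definition pt (i : nat) : X := vertex_of_ord (inord i : 'I_(size l).*2.+2).

Lemma ptE i : (i < npoints l)%N -> vertex_val (pt i) = i.
Proof. by move=> il; rewrite /= inordK. Qed.

Lemma pt_val (x : X) : pt (vertex_val x) = x.
Proof. by apply/val_inj; rewrite /= inordK // vertex_lt. Qed.

Lemma mdist_pt i j : (i < npoints l)%N -> (j < npoints l)%N ->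
  mdist (pt i) (pt j) = (vdist (size l) l i j)%:R :> R.
Proof. by move=> il jl; rewrite mdist_space !ptE. Qed.

Lemma diameter_space : diameter X = (2 ^ size l)%:R.
Proof.
apply/le_anti/andP; split; rewrite /diameter.
  apply: bigmax_le => // -[x y] _ /=; rewrite mdist_space ler_nat.
  exact: (vdist_le (leqnn _)).2.
have -> : (2 ^ size l)%:R = mdist (pt 0) (pt 1) :> R.
  rewrite mdist_pt //; congr (_%:R).
  have := @vdist_cat (size l) l [::] 0 1; rewrite cats0 => -> //=.
exact: (le_bigmax_cond _ (fun p : X * X => mdist p.1 p.2) (j := (pt 0, pt 1))).
Qed.

Lemma min_distance_space : min_distance X = 1.
Proof.
apply/le_anti/andP; split; rewrite /min_distance.
  have [s_lt t_lt] := ends_lt l.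
  have <- : mdist (pt (ends l).1) (pt (ends l).2) = 1 :> R.
    by rewrite mdist_pt // vdist_ends // /edge_len subnn.
  apply: (bigmin_le_cond _ (fun p : X * X => mdist p.1 p.2)
    (j := (pt (ends l).1, pt (ends l).2))) => //=.
  rewrite mdist_pt // vdist_ends // pnatr_eq0 -lt0n; exact: edge_len_gt0.
apply: le_bigmin => [|[x y] /=].
  by rewrite diameter_space ler1n expn_gt0.
by rewrite mdist_space pnatr_eq0 ler1n lt0n.
Qed.

Lemma aspect_ratio_space : aspect_ratio X = 2 ^+ size l.
Proof. by rewrite /aspect_ratio diameter_space min_distance_space divr1 natrX. Qed.

(** Let k be the first step whose edge length is below r, or m if there is none. One ball centred at
    an end of the edge reached at step k covers all later points. The six points completing the
    first k steps receive a ball each. The older points are at mutual distance at least 8 * 2 ^ (m -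
    k) >= 4r, so at most one of them lies in the ball of radius 2r. This makes at most 8 <= 2 ^ 4
    centers. *)
Lemma ddim_space : ddim_le X 4.
Proof.
move=> x r r0.
pose m := size l.
pose small k := (k == m) || ((2 ^ (m - k))%:R < r).
have [k /orP k_small k_min] : {k | small k & forall j, small j -> (k <= j)%N}.
  have ex : exists k, small k by exists m; rewrite /small eqxx.
  by case: (ex_minnP ex) => k sk km; exists k.
have km : (k <= m)%N by apply: k_min; rewrite /small eqxx.
(* By minimality of [k], the edges one step earlier still have length at least [r]. *)
have r_le : (0 < k)%N -> r <= (2 ^ (m - k)).*2%:R.
  move=> k0; rewrite leNgt; apply/negP => lt_r.
  have /k_min : small k.-1.
    rewrite /small; apply/orP; right; rewrite -mul2n -expnS in lt_r.
    by rewrite (_ : (m - k.-1)%N = (m - k).+1) //; lia.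
  by lia.
(* The most recent choice is the head of [l], so dropping [m - k] of them leaves the first [k]
   steps. *)
set l2 := drop (m - k) l.
have size_l2 : size l2 = k by rewrite size_drop -/m; lia.
have lE : l = take (m - k) l ++ l2 by rewrite cat_take_drop.
have edge_len_l2 : edge_len m l2 = (2 ^ (m - k))%N by rewrite /edge_len size_l2.
(* The points numbered below [b] are those present three steps before step [k]; when [k < 3], all of
   the at most six points get their own ball. *)
pose b := if (3 <= k)%N then npoints (drop 3 l2) else 0%N.
have bE : (npoints l2 <= b + 6)%N.
  by rewrite /b; case: ifP => k3; rewrite /npoints ?(size_drop 3 l2) size_l2; lia.
pose old := [pick y : X | (y < b)%N && (mdist x y < 2 * r)].
pose centers : seq X := pt (ends l2).1 ::
  (if old is Some z then [:: z] else [::]) ++ [seq pt i | i <- iota b 6].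
exists [set y in centers].
  rewrite cardsE (leq_trans (card_size _)) //.
  by rewrite /centers; case: (old).
move=> y; rewrite ball_space => xy.
have [y_old|y_mid] := ltnP y b.
  exists y; last by rewrite ball_space mdistxx.
  suff : old = Some y by move=> oldE; rewrite !inE oldE /= inE eqxx orbT.
  rewrite /old; case: pickP => [z /andP[zb xz]|/(_ y)]; last by rewrite y_old xy.
  congr Some; apply/eqP/negPn/negP => zy.
  have k3 : (3 <= k)%N by move: zb; rewrite /b; case: ifP.
  have : mdist z y < 4 * r.
    apply: (le_lt_trans (metric_triangle z x y)); rewrite (metric_sym z); lra.
  apply/negP; rewrite -leNgt; apply: (@le_trans _ _ (8 * 2 ^ (m - k))%:R).
    have := r_le (ltn_trans (isT : 0 < 2)%N k3).
    rewrite -muln2 !natrM => ?; lra.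
  rewrite mdist_space -/m ler_nat.
  move: zb y_old zy; rewrite /b k3 -val_eqE /=.
  move=> zb y_old zy.
  have lE3 : l = (take (m - k) l ++ take 3 l2) ++ drop 3 l2.
    by rewrite -catA cat_take_drop.
  have vdist_l3 i j : (i < npoints (drop 3 l2))%N -> (j < npoints (drop 3 l2))%N ->
      vdist m l i j = vdist m (drop 3 l2) i j.
    by move=> il jl; rewrite [in LHS]lE3 vdist_cat.
  rewrite vdist_l3 //.
  apply: leq_trans (edge_len_le_vdist _ _ _) => //.
  rewrite /edge_len (size_drop 3 l2) size_l2 -/m -(expnD 2 3) leq_exp2l //; lia.
have [y_l2|y_late] := ltnP y (npoints l2).
  exists y; last by rewrite ball_space mdistxx.
  rewrite !inE mem_cat; apply/orP; right; apply/orP; right.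
  apply/mapP; exists (vertex_val y); last by rewrite pt_val.
  rewrite mem_iota y_mid /=; lia.
exists (pt (ends l2).1); first by rewrite !inE eqxx.
have y_lt := vertex_lt y.
have k_lt : (k < m)%N.
  rewrite ltn_neqAle km andbT; apply/eqP => kE.
  by move: y_late; rewrite /npoints size_l2 kE leqNgt y_lt.
have lt_r : (2 ^ (m - k))%:R < r by case: k_small => // /eqP; lia.
rewrite ball_space; apply: le_lt_trans lt_r.
have [s_lt _] := ends_lt l2.
have s_lt' : ((ends l2).1 < npoints l)%N.
  by apply: leq_trans s_lt _; rewrite /npoints size_l2 -/m; lia.
rewrite mdist_space ptE // ler_nat -edge_len_l2 vdistC -/m.
have size_l : (size (take (m - k) l ++ l2) <= m)%N by rewrite -lE.
have [_ /(_ y y_late)] := vdist_later size_l.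
by rewrite -lE; apply.
Qed.

End SpaceProperties.

(* The edges of the final graph other than the last current edge. *)
Fixpoint side_edges (l : choice_seq) : seq (nat * nat) :=
  if l is c :: l' then
    let u := (ends l).1 in
    let v := if c.1 then (ends l').2 else (ends l').1 in
    let q := (npoints l' + ~~ c.2)%N in
    [:: ((ends l).2, v), (q, u), (q, v) & side_edges l']
  else [::].

Lemma side_edges_cons c l : side_edges (c :: l) =
  [:: (npoints l + c.2, if c.1 then (ends l).2 else (ends l).1),
      (npoints l + ~~ c.2, if c.1 then (ends l).1 else (ends l).2),
      (npoints l + ~~ c.2, if c.1 then (ends l).2 else (ends l).1)
    & side_edges l]%N.
Proof. by []. Qed.

(** Edges generate the metric: a reflexive symmetric relation that holds on the edges and can be
    composed along geodesics holds everywhere. By induction on the steps, it passes from s to t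
    through the midpoint N, hence to all old points, and from a new vertex to an old one through the
    nearer of s and t. *)
Lemma geodesic_closure m l (C : nat -> nat -> Prop) : (size l <= m)%N ->
  (forall x, C x x) -> (forall x y, C x y -> C y x) ->
  (forall x y z, (x < npoints l)%N -> (y < npoints l)%N -> (z < npoints l)%N ->
     C x y -> C y z -> vdist m l x z = (vdist m l x y + vdist m l y z)%N -> C x z) ->
  C (ends l).1 (ends l).2 ->
  (forall e, e \in side_edges l -> C e.1 e.2) ->
  forall x y, (x < npoints l)%N -> (y < npoints l)%N -> C x y.
Proof.
move=> + Cxx CC; elim: l => [|c l IH] lm Ctrans Cend Cside.
  move=> [|[|//]] [|[|//]] _ _; [exact: Cxx|exact: Cend| |exact: Cxx].
  exact/CC/Cend.
have [s_lt t_lt] := ends_lt l.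
move: Cend; rewrite ends_cons1 ends_cons2 => Cend.
have /= C1 := Cside (_, _) (mem_head _ _).
have /= C2 : C (npoints l + ~~ c.2)%N (if c.1 then (ends l).1 else (ends l).2).
  by apply: (Cside (_, _)); rewrite side_edges_cons !inE eqxx orbT.
have /= C3 : C (npoints l + ~~ c.2)%N (if c.1 then (ends l).2 else (ends l).1).
  by apply: (Cside (_, _)); rewrite side_edges_cons !inE eqxx !orbT.
set N := npoints l in s_lt t_lt Cend C1 C2 C3 *.
have Cnew x : (N <= x)%N -> (x < npoints (c :: l))%N ->
    C x (ends l).1 /\ C x (ends l).2.
  move=> Nx xN.
  have [->|->] : x = (N + c.2)%N \/ x = (N + ~~ c.2)%N.
    by move: xN; rewrite npoints_cons -/N; case: c.2; lia.
  - by move: Cend C1; case: c.1 => /CC.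
  - by move: C2 C3; case: c.1.
have wd x : (x < N)%N -> (x < npoints (c :: l))%N.
  by rewrite npoints_cons -/N; lia.
have N_lt : (N < npoints (c :: l))%N by rewrite npoints_cons -/N; lia.
have [eNs eNt] := vdist_new_ends m c (leqnn N).
have Cold x y : (x < N)%N -> (y < N)%N -> C x y.
  apply: IH => //; first exact: ltnW.
  - move=> x' y' z' x'N y'N z'N xy yz dxz.
    by apply: (Ctrans x' y' z'); rewrite ?vdist_old ?wd.
  (* The edge replaced at this step is recovered as the geodesic s, N, t. *)
  - have [Cs Ct] := Cnew N (leqnn _) N_lt.
    apply: (Ctrans _ N) => //; [exact: wd|exact: wd|exact/CC|].
    by rewrite (vdistC _ _ _ N) eNs eNt vdist_old // vdist_ends ?(ltnW lm) // addnn
               -edge_len_cons.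
  - by move=> e el; apply: Cside; rewrite side_edges_cons !inE el !orbT.
have Cmix x y : (N <= x)%N -> (x < npoints (c :: l))%N -> (y < N)%N -> C x y.
  move=> Nx xN yN; have [Cs Ct] := Cnew x Nx xN.
  have [es et] := vdist_new_ends m c Nx.
  have [st|ts] := leqP (vdist m l (ends l).1 y) (vdist m l (ends l).2 y).
    apply: (Ctrans x (ends l).1 y) => //; try exact: wd; first exact: Cold.
    by rewrite es vdist_new // vdist_old //; congr (_ + _)%N; exact/minn_idPl.
  apply: (Ctrans x (ends l).2 y) => //; try exact: wd; first exact: Cold.
  by rewrite et vdist_new // vdist_old //; congr (_ + _)%N; apply/minn_idPr/ltnW.
move=> x y xN yN.
have [xo|xn] := ltnP x N; have [yo|yn] := ltnP y N.
- exact: Cold.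
- exact/CC/Cmix.
- exact: Cmix.
- have [->|xy] := eqVneq x y; first exact: Cxx.
  have [Cs _] := Cnew x xn xN; have [Cs' _] := Cnew y yn yN.
  have [es _] := vdist_new_ends m c xn; have [es' _] := vdist_new_ends m c yn.
  apply: (Ctrans x (ends l).1 y) => //; [exact: wd|exact/CC|].
  by rewrite (vdistC _ _ (ends l).1 y) es es' vdist_new2 // addnn.
Qed.

(** * Series-parallel graphs *)

Section SeriesParallel.
Variable V : finType.
Implicit Types (E F : {set {set V}}) (s t : V).
Local Notation cover := finset.cover.

Lemma cover_setU E F : cover (E :|: F)%SET = (cover E :|: cover F)%SET.
Proof. by rewrite /finset.cover finset.bigcup_setU. Qed.

Lemma cover_edge s t : cover [set [set s; t]%SET]%SET = [set s; t]%SET.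
Proof. by rewrite finset.cover1. Qed.

Lemma series_parallel_sym E s t : series_parallel E s t -> series_parallel E t s.
Proof.
elim=> {E s t} [s t st|E F s m t _ IH1 _ IH2 EF|E F s t _ IH1 _ IH2 EF dEF].
- by rewrite (finset.setUC [set s]%SET); apply: SP_edge; rewrite eq_sym.
- by rewrite finset.setUC; apply: SP_series IH2 IH1 _; rewrite finset.setIC.
- by apply: SP_parallel IH1 IH2 _ dEF; rewrite EF finset.setUC.
Qed.

Lemma series_parallel_edge E s t e : series_parallel E s t -> e \in E ->
  exists u v, u != v /\ e = [set u; v]%SET.
Proof.
move=> spE; elim: spE e => {E s t}
  [s t st|E F s m t _ IH1 _ IH2 _|E F s t _ IH1 _ IH2 _ _] e.
- by rewrite inE => /eqP ->; exists s, t.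
- by rewrite inE => /orP[/IH1|/IH2].
- by rewrite inE => /orP[/IH1|/IH2].
Qed.

Lemma series_parallel_terminals E s t : series_parallel E s t ->
  s \in cover E /\ t \in cover E.
Proof.
elim=> {E s t} [s t st|E F s m t _ [sE _] _ [_ tF] _|E F s t _ [sE tE] _ _ _ _].
- by rewrite cover_edge !inE !eqxx orbT.
- by rewrite cover_setU !inE sE tF orbT.
- by rewrite cover_setU !inE sE tE.
Qed.

(** One refinement step: [F], standing for the side up, is put in series with the edge pv, and the
    result in parallel with the path u, q, v. *)
Lemma series_parallel_diamond F u p v q : series_parallel F u p ->
  u != v -> q != u -> q != v -> v \notin cover F -> q \notin cover F ->
  series_parallel (F :|: [set [set p; v]] :|:
                   ([set [set u; q]] :|: [set [set q; v]]))%SET u v.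
Proof.
move=> spF uv qu qv vF qF.
have [uF pF] := series_parallel_terminals spF.
have pv : p != v by apply: contraNneq vF => <-.
have qp : q != p by apply: contraNneq qF => ->.
apply: SP_parallel.
- apply: SP_series spF (SP_edge pv) _; rewrite cover_edge.
  apply/setP => y; rewrite !inE; have [->|_] := eqVneq y p; first by rewrite pF.
  by have [->|_] := eqVneq y v; rewrite ?andbF // (negPf vF).
- apply: SP_series; [apply: SP_edge|exact: (SP_edge qv)|]; first by rewrite eq_sym.
  rewrite !cover_edge; apply/setP => y; rewrite !inE.
  have [->|_] := eqVneq y q; first by rewrite orbT.
  by have [->|_] := eqVneq y u; rewrite ?(negPf uv) ?andbF.
- rewrite !cover_setU !cover_edge; apply/setP => y; rewrite !inE.
  have [->|yu] := eqVneq y u; first by rewrite uF.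
  have [->|yv] := eqVneq y v; first by rewrite !orbT.
  have [->|yq] := eqVneq y q; rewrite ?andbF //=.
  by rewrite (negPf qF) (negPf qp).
- rewrite -finset.setI_eq0; apply/eqP/setP => e; rewrite !inE.
  apply/negP => /andP[eF /orP eq].
  have qe : q \in e by case: eq => /eqP ->; rewrite !inE eqxx ?orbT.
  move: eF => /orP[eF|/eqP eE].
    by move/negP: qF; apply; apply/bigcupP; exists e.
  by move: qe; rewrite eE !inE (negPf qp) (negPf qv).
Qed.

End SeriesParallel.

(** * The series-parallel graph underlying the metric *)

Section SpaceGraph.
Variables (R : realType) (l : choice_seq).
Local Notation X := (point_space R l).
Local Notation pt := (@pt R l).
Local Notation cover := finset.cover.

Lemma pt_inj i j : (i < npoints l)%N -> (j < npoints l)%N ->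
  (pt i == pt j) = (i == j).
Proof.
move=> il jl; apply/eqP/eqP => [|-> //] ij.
by rewrite -(ptE R il) ij ptE.
Qed.

Lemma eq_pt (y : X) i : (i < npoints l)%N -> (y == pt i) = (y == i :> nat).
Proof. by move=> il; rewrite -{1}(pt_val y) pt_inj ?vertex_lt. Qed.

(* The graph is assembled from the inside out: [F] is what the edge [ends k] is
   eventually refined into. *)
Lemma space_graph_aux (k : choice_seq) (F : {set {set X}}) :
  (npoints k <= npoints l)%N ->
  series_parallel F (pt (ends k).1) (pt (ends k).2) ->
  (forall y : X, (y \in cover F) =
    [|| y == pt (ends k).1, y == pt (ends k).2 | npoints k <= y]%N) ->
  exists E : {set {set X}}, [/\ series_parallel E (pt 0) (pt 1),
    cover E = [set: X]%SET, F \subset E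
  & forall e, e \in side_edges k -> [set pt e.1; pt e.2]%SET \in E].
Proof.
elim: k F => [|c k IH] F kl spF covF.
  exists F; split=> //; apply/setP => y; rewrite covF !inE /= !eq_pt //.
  by case: (vertex_val y) => [|[]].
have [s_lt t_lt] := ends_lt k.
rewrite npoints_cons in kl.
have kl' : (npoints k <= npoints l)%N by lia.
rewrite ends_cons1 ends_cons2 in spF covF.
(* In the 4-cycle u, p, v, q the side up is the one refined further; u and v are the ends of [k], in
   an order given by [c.1]. *)
set u := if c.1 then _ else _ in spF covF.
pose v := if c.1 then (ends k).2 else (ends k).1.
pose q := (npoints k + ~~ c.2)%N.
set p := (npoints k + c.2)%N in spF covF.
have u_lt : (u < npoints k)%N by rewrite /u; case: c.1.
have v_lt : (v < npoints k)%N by rewrite /v; case: c.1.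
have pq : p = npoints k /\ q = (npoints k).+1 \/
          q = npoints k /\ p = (npoints k).+1.
  by rewrite /p /q; case: c.2; lia.
have uv : u != v by rewrite /u /v; have := ends_neq k; case: c.1; rewrite // eq_sym.
have [ul vl] : (u < npoints l)%N /\ (v < npoints l)%N by split; lia.
have [pl ql] : (p < npoints l)%N /\ (q < npoints l)%N by split; lia.
have uv' : pt u != pt v by rewrite pt_inj.
have qu : pt q != pt u by rewrite pt_inj //; lia.
have qv : pt q != pt v by rewrite pt_inj //; lia.
have vF : pt v \notin cover F.
  rewrite covF !pt_inj // ptE // (eq_sym v) (negPf uv) npoints_cons; lia.
have qF : pt q \notin cover F.
  rewrite covF !pt_inj // ptE // npoints_cons; lia.
have spF' := series_parallel_diamond spF uv' qu qv vF qF.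
set F' := (X in series_parallel X _ _) in spF'.
have {}spF' : series_parallel F' (pt (ends k).1) (pt (ends k).2).
  by move: spF'; rewrite /u /v; case: c.1 => // /series_parallel_sym.
have covF' (y : X) : (y \in cover F') =
    [|| y == pt (ends k).1, y == pt (ends k).2 | npoints k <= y]%N.
  have -> : [|| y == pt (ends k).1, y == pt (ends k).2 | npoints k <= y]%N =
      [|| y == pt u, y == pt v | npoints k <= y]%N.
    by rewrite /u /v; case: c.1 => //; rewrite orbCA.
  rewrite !cover_setU !cover_edge !inE covF !eq_pt // npoints_cons; lia.
have [E [spE covE F'E sideE]] := IH F' kl' spF' covF'.
have inE' e : e \in F' -> e \in E by move/fintype.subsetP: F'E; apply.
exists E; split=> //.
  by apply/fintype.subsetP => e eF; apply: inE'; rewrite !inE eF.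
move=> e; rewrite side_edges_cons !inE -/u -/v -/q -/p.
move=> /or4P[/eqP->|/eqP->|/eqP->|/sideE //]; apply: inE'; rewrite !inE.
- by rewrite eqxx orbT.
- by rewrite finset.setUC eqxx !orbT.
- by rewrite eqxx !orbT.
Qed.

Lemma space_graph : exists E : {set {set X}},
  [/\ series_parallel_graph E,
      forall e, e \in E -> exists u v, u != v /\ e = [set u; v]%SET,
      edge_rel E (pt (ends l).1) (pt (ends l).2)
    & forall e, e \in side_edges l -> edge_rel E (pt e.1) (pt e.2)].
Proof.
have [s_lt t_lt] := ends_lt l.
have st : pt (ends l).1 != pt (ends l).2 by rewrite pt_inj // ends_neq.
have [|E [spE covE FE sideE]] := space_graph_aux (leqnn _) (SP_edge st).
  move=> y; rewrite cover_edge !inE (leqNgt _ y).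
  by rewrite (vertex_lt y) orbF.
exists E; split=> //.
- by split=> //; exists (pt 0), (pt 1).
- by move=> e; apply: series_parallel_edge spE.
- by apply: (fintype.subsetP FE); rewrite inE.
Qed.

End SpaceGraph.

(** * Geodesic walks and shortest path metrics *)

Section Geodesics.
Variables (R : realType) (X : finMetricType R) (E : {set {set X}}).

(** An edge is an unordered pair; taking the maximum over its points yields their distance without
    choosing an order. *)
Definition edge_weight (e : {set X}) : R :=
  \big[Order.max/0]_(p : X * X | (p.1 \in e) && (p.2 \in e)) mdist p.1 p.2.

Lemma edge_weightE u v : edge_weight [set u; v]%SET = mdist u v.
Proof.
apply/le_anti/andP; split; last first.
  apply: (le_bigmax_cond _ (fun p : X * X => mdist p.1 p.2) (j := (u, v))).
  by rewrite /= !inE !eqxx orbT.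
apply: bigmax_le => [|[x y]] /=; first exact: mdist_ge0.
rewrite !inE => /andP[/orP[]/eqP-> /orP[]/eqP->];
  by rewrite ?mdistxx ?mdist_ge0 // metric_sym.
Qed.

Lemma mdist_le_walk x p : mdist x (last x p) <= walk_length edge_weight x p.
Proof.
elim: p x => [|y p IH] x /=; first by rewrite mdistxx.
rewrite edge_weightE; apply: le_trans (metric_triangle x y _) _.
by rewrite lerD2l.
Qed.

Lemma walk_length_cat (w : {set X} -> R) x p1 p2 :
  walk_length w x (p1 ++ p2) = walk_length w x p1 + walk_length w (last x p1) p2.
Proof.
by elim: p1 x => [|y p1 IH] x /=; rewrite ?add0r // IH addrA.
Qed.

Definition geodesic x y := exists p, [/\ path (edge_rel E) x p, last x p = y
  & mdist x y = walk_length edge_weight x p].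

Lemma geodesic_refl x : geodesic x x.
Proof. by exists [::]; split => //; rewrite mdistxx. Qed.

Lemma geodesic_edge x y : edge_rel E x y -> geodesic x y.
Proof. by move=> xy; exists [:: y]; rewrite /= xy edge_weightE addr0. Qed.

Lemma geodesic_trans y x z : geodesic x y -> geodesic y z ->
  mdist x z = mdist x y + mdist y z -> geodesic x z.
Proof.
move=> [p [xp py xy]] [q [yq qz yz]] xz; exists (p ++ q).
by rewrite cat_path last_cat walk_length_cat xp py yq qz xz xy yz.
Qed.

End Geodesics.

Lemma space_shortest_path (R : realType) (l : choice_seq) :
  exists (E : {set {set point_space R l}}) (w : {set point_space R l} -> R),
    [/\ series_parallel_graph E, forall e, e \in E -> 0 < w e
      & shortest_path_metric E w].
Proof.
have [E [spE edgesE endE sideE]] := space_graph R l.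
exists E, (@edge_weight R (point_space R l)); split=> //.
  by move=> e /edgesE[u [v [uv ->]]]; rewrite edge_weightE mdist_gt0.
move=> x y; split; last by move=> p _ <-; exact: mdist_le_walk.
have edge_sym (a b : point_space R l) : edge_rel E a b -> edge_rel E b a.
  by rewrite /edge_rel finset.setUC.
(* Both directions are included to make [C] symmetric without reversing walks. *)
pose C i j := geodesic E (pt R l i) (pt R l j) /\ geodesic E (pt R l j) (pt R l i).
suff [+ _] : C x y by rewrite !pt_val.
apply: (@geodesic_closure (size l) l C); rewrite ?vertex_lt //.
- by split; exact: geodesic_refl.
- by move=> i j [].
- move=> i j k il jl kl [ij ji] [jk kj] dik; split.
    by apply: geodesic_trans ij jk _; rewrite !mdist_pt // dik natrD.
  apply: geodesic_trans kj ji _; rewrite !mdist_pt //.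
  by rewrite vdistC dik natrD addrC vdistC (vdistC _ _ i).
- by split; apply: geodesic_edge => //; exact: edge_sym.
- move=> e /sideE He; split; apply: geodesic_edge => //; exact: edge_sym.
Qed.

(** * Squared distances in l2: the parallelogram law and the Cauchy-Schwarz inequality *)

Section L2.
Variable R : realType.
Implicit Types (u v w z : nat -> R) (x y s t a b : l2 R).

Definition esqn u : \bar R := (\sum_(0 <= i <oo) ((u i) ^+ 2)%:E)%E.

Definition sqn u : R := fine (esqn u).

Lemma esqn_ge0 u : (0 <= esqn u)%E.
Proof. by apply: nneseries_ge0 => i _ _; rewrite lee_fin sqr_ge0. Qed.

Lemma sqn_ge0 u : 0 <= sqn u.
Proof. exact/fine_ge0/esqn_ge0. Qed.

Lemma esqnE u : (esqn u < +oo)%E -> esqn u = (sqn u)%:E.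
Proof. by move=> u_lt; rewrite fineK // ge0_fin_numE // esqn_ge0. Qed.

Lemma esqn_comb u v w (c d e : R) : 0 <= c -> 0 <= d -> 0 <= e ->
  (\sum_(0 <= i <oo) (c * u i ^+ 2 + d * v i ^+ 2 + e * w i ^+ 2)%:E =
   c%:E * esqn u + d%:E * esqn v + e%:E * esqn w)%E.
Proof.
move=> c0 d0 e0; rewrite -!nneseriesZl; try by move=> i _; rewrite lee_fin sqr_ge0.
have pos r z i : 0 <= r -> (0 <= (r%:E * (z i ^+ 2)%:E) :> \bar R)%E.
  by move=> r0; rewrite mule_ge0 // lee_fin // sqr_ge0.
rewrite -!nneseriesD; try by move=> i _ _; rewrite ?adde_ge0 // pos.
by apply: eq_eseriesr => i _; rewrite !EFinD !EFinM.
Qed.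

Lemma esqn_comb_lty u v w (c d : R) : 0 <= c -> 0 <= d ->
  (forall i, w i ^+ 2 <= c * u i ^+ 2 + d * v i ^+ 2) ->
  (esqn u < +oo)%E -> (esqn v < +oo)%E -> (esqn w < +oo)%E.
Proof.
move=> c0 d0 wuv u_lt v_lt.
apply: (@le_lt_trans _ _ (c%:E * esqn u + d%:E * esqn v + 0%:E * esqn v)%E).
  rewrite -esqn_comb //; apply: lee_nneseries => [i _ _|i _].
    by rewrite lee_fin sqr_ge0.
  by rewrite lee_fin mul0r addr0.
by rewrite (esqnE u_lt) (esqnE v_lt) -!EFinM -!EFinD ltry.
Qed.

(** This reduces inequalities between squared norms to coordinatewise ones; terms that are absent
    get coefficient 0. *)
Lemma sqn_comb_le u v w z (y : nat -> R) (c d e f g : R) :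
  0 <= c -> 0 <= d -> 0 <= e -> 0 <= f -> 0 <= g ->
  (esqn u < +oo)%E -> (esqn v < +oo)%E ->
  (esqn w < +oo)%E -> (esqn z < +oo)%E -> (esqn y < +oo)%E ->
  (forall i, c * u i ^+ 2 + d * v i ^+ 2 <=
             e * w i ^+ 2 + f * z i ^+ 2 + g * y i ^+ 2) ->
  c * sqn u + d * sqn v <= e * sqn w + f * sqn z + g * sqn y.
Proof.
move=> c0 d0 e0 f0 g0 u_lt v_lt w_lt z_lt y_lt le_sum.
rewrite -lee_fin !EFinD !EFinM -!esqnE // -esqn_comb //.
rewrite -[leLHS]adde0 -[X in (_ + X)%E](mul0e (esqn u)) -esqn_comb //.
apply: lee_nneseries => [i _ _|i _]; last by rewrite lee_fin mul0r addr0.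
by rewrite lee_fin mul0r addr0 addr_ge0 // mulr_ge0 // sqr_ge0.
Qed.

Lemma poweR_abs_sqr u i : (`|(EFin \o u) i| `^ 2 = (u i ^+ 2)%:E)%E.
Proof.
rewrite /comp abse_EFin poweR_EFin powR_mulrn //.
by rewrite real_normK // num_real.
Qed.

Lemma esqn_l2_lty x : (esqn x < +oo)%E.
Proof.
have := Lfunction_finite (lee12 R) x; rewrite /finite_norm Lnorm_counting //.
move=> /lty_poweRy; rewrite invr_eq0 pnatr_eq0 => /(_ isT).
apply: le_lt_trans; apply: lee_nneseries => [i _ _|i _].
  by rewrite lee_fin sqr_ge0.
by rewrite poweR_abs_sqr.
Qed.

Definition sqd x y : R := sqn (x \- y).

Lemma esqnB_lty x y : (esqn (x \- y)%R < +oo)%E.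
Proof.
apply: (@esqn_comb_lty x y _ 2 2) => // [i /=|//|//]; [|exact: esqn_l2_lty..].
have := sqr_ge0 (x i + y i); nra.
Qed.

Lemma l2distE x y : l2dist x y = (Num.sqrt (sqd x y))%:E.
Proof.
rewrite /l2dist Lnorm_counting //.
have -> : (\sum_(k <oo) (`|(EFin \o (x \- y)%R) k| `^ 2) = esqn (x \- y)%R)%E.
  by apply: eq_eseriesr => i _; rewrite poweR_abs_sqr.
by rewrite esqnE ?esqnB_lty // poweR_EFin powR12_sqrt // sqn_ge0.
Qed.

(** Twice the vector from the midpoint of s and t to x. *)
Definition median x s t : nat -> R := fun i => 2 * x i - s i - t i.

Lemma esqn_median_lty x s t : (esqn (median x s t) < +oo)%E.
Proof.
apply: (@esqn_comb_lty (x \- s) (x \- t) _ 2 2) => // [i /=|//|//]; [|exact: esqnB_lty..].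
rewrite /median; have := sqr_ge0 (s i - t i); nra.
Qed.

(** The parallelogram law for s - x and x - t, whose sum is s - t and whose difference is the median
    vector up to sign. *)
Lemma median_sqd x s t :
  2 * sqd s x + 2 * sqd x t = sqd s t + sqn (median x s t).
Proof.
have le1 : 2 * sqd s x + 2 * sqd x t <=
    1 * sqd s t + 1 * sqn (median x s t) + 0 * sqd s t.
  apply: (@sqn_comb_le (s \- x) (x \- t) (s \- t) (median x s t) (s \- t));
    rewrite ?esqnB_lty ?esqn_median_lty // => i.
  by rewrite /median /=; lra.
have le2 : 1 * sqd s t + 1 * sqn (median x s t) <=
    2 * sqd s x + 2 * sqd x t + 0 * sqd s t.
  apply: (@sqn_comb_le (s \- t) (median x s t) (s \- x) (x \- t) (s \- t));
    rewrite ?esqnB_lty ?esqn_median_lty // => i.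
  by rewrite /median /=; lra.
apply/le_anti/andP; split; lra.
Qed.

(** The discriminant argument, at the minimizer r = c / d. If d = 0, the inequality becomes linear
    in r, and r = (e + 1) / (2c) contradicts it unless c = 0. *)
Lemma sqr_le_of_quadratic (c d e : R) : 0 <= d -> 0 <= e ->
  (forall r, 0 < r -> 2 * r * c <= r ^+ 2 * d + e) -> 0 <= c -> c ^+ 2 <= d * e.
Proof.
move=> d0 e0 quad; rewrite le_eqVlt => /predU1P[<-|c0].
  by rewrite expr0n /= mulr_ge0.
have [d00|d_neq0] := eqVneq d 0.
  have r0 : 0 < (e + 1) / (2 * c) by rewrite divr_gt0 //; lra.
  have := quad _ r0; rewrite d00 mulr0 add0r.
  have -> : 2 * ((e + 1) / (2 * c)) * c = e + 1.
    by rewrite mulrAC mulrC divfK // gt_eqF // mulr_gt0.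
  by lra.
have dgt0 : 0 < d by rewrite lt_neqAle eq_sym d_neq0.
have := quad _ (divr_gt0 c0 dgt0).
have -> : 2 * (c / d) * c = 2 * (c ^+ 2 / d) by lra.
have -> : (c / d) ^+ 2 * d = c ^+ 2 / d.
  by rewrite exprMn -mulrA [d^-1 ^+ 2]expr2 mulfVK.
move=> H; have : c ^+ 2 / d <= e by lra.
by rewrite ler_pdivrMr // mulrC.
Qed.

(** The difference on the left is, up to sign, the inner product of s - t with the median vector, so
    this is Cauchy-Schwarz. Inner products are avoided by expanding the squares of r (s - t) plus or
    minus the median. *)
Lemma median_sqd_diff x s t :
  (sqd s x - sqd x t) ^+ 2 <= sqd s t * sqn (median x s t).
Proof.
suff H r : 0 < r ->
    2 * r * `|sqd s x - sqd x t| <= r ^+ 2 * sqd s t + sqn (median x s t).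
  by rewrite -real_normK ?num_real //; apply: sqr_le_of_quadratic H _; rewrite ?sqn_ge0.
move=> r0; have r0' := ltW r0.
have pt i : 0 <= (r * (s i - t i) + (2 * x i - s i - t i)) ^+ 2 /\
            0 <= (r * (s i - t i) - (2 * x i - s i - t i)) ^+ 2.
  by rewrite !sqr_ge0.
have H1 : 2 * r * sqd s x + 0 * sqd s x <=
    2 * r * sqd x t + r ^+ 2 * sqd s t + 1 * sqn (median x s t).
  apply: (@sqn_comb_le (s \- x) (s \- x) (x \- t) (s \- t) (median x s t));
    rewrite ?esqnB_lty ?esqn_median_lty ?mulr_ge0 ?sqr_ge0 // => i.
  by have [+ _] := pt i; rewrite /median /=; lra.
have H2 : 2 * r * sqd x t + 0 * sqd s x <=
    2 * r * sqd s x + r ^+ 2 * sqd s t + 1 * sqn (median x s t).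
  apply: (@sqn_comb_le (x \- t) (s \- x) (s \- x) (s \- t) (median x s t));
    rewrite ?esqnB_lty ?esqn_median_lty ?mulr_ge0 ?sqr_ge0 // => i.
  by have [_ +] := pt i; rewrite /median /=; lra.
by case: ler0P => _; lra.
Qed.

(** The two medians differ by 2 (a - b), and the squared norm of a difference is at most twice the
    sum of the squared norms. *)
Lemma sqd_le_medians a b s t :
  2 * sqd a b <= sqn (median a s t) + sqn (median b s t).
Proof.
have : 2 * sqd a b + 0 * sqd a b <=
    1 * sqn (median a s t) + 1 * sqn (median b s t) + 0 * sqd a b.
  apply: (@sqn_comb_le (a \- b) (a \- b) (median a s t) (median b s t) (a \- b));
    rewrite ?esqnB_lty ?esqn_median_lty // => i.
  have := sqr_ge0 (median a s t i + median b s t i); rewrite /median /=; lra.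
lra.
Qed.

End L2.

(** * Growth of the potential in one refinement step *)

Section Potential.
Variable R : realType.

(** With V = ((s - t) / 2L, K) and W = (median / 2L, 0), the right side is |V - W| + |V + W|, which
    is at least twice the norm of V plus the component of W orthogonal to V. By Cauchy-Schwarz, that
    component has squared norm at least M - D M / (K^2 + D) = K^2 M / (K^2 + D). *)
Lemma potential_midpoint (K D M A B : R) : 0 < K -> 0 <= D -> 0 <= M ->
  0 <= A -> 0 <= B -> A + B = 2 * (D + M) -> (A - B) ^+ 2 <= 16 * (D * M) ->
  2 * Num.sqrt (K ^+ 2 + D + K ^+ 2 * M / (K ^+ 2 + D)) <=
    Num.sqrt (K ^+ 2 + A) + Num.sqrt (K ^+ 2 + B).
Proof.
move=> K0 D0 M0 A0 B0 ABs ABd.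
have K20 : 0 < K ^+ 2 by rewrite exprn_gt0.
set N2 := K ^+ 2 + D; have N20 : 0 < N2 by rewrite /N2; lra.
have p0 := sqrtr_ge0 (K ^+ 2 + A); have q0 := sqrtr_ge0 (K ^+ 2 + B).
have pE : Num.sqrt (K ^+ 2 + A) ^+ 2 = K ^+ 2 + A by rewrite sqr_sqrtr //; lra.
have qE : Num.sqrt (K ^+ 2 + B) ^+ 2 = K ^+ 2 + B by rewrite sqr_sqrtr //; lra.
set p := Num.sqrt (K ^+ 2 + A) in p0 pE *.
set q := Num.sqrt (K ^+ 2 + B) in q0 qE *.
have MK0 : 0 <= K ^+ 2 * M / N2.
  by rewrite divr_ge0 ?mulr_ge0 // ltW.
set e := K ^+ 2 * M / N2 in MK0 *.
have eE : e * N2 = K ^+ 2 * M by rewrite /e divfK // gt_eqF.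
have eM : e <= M.
  by rewrite ler_pdivrMr // mulrC ler_wpM2l // /N2; lra.
have pq_ge : N2 - M + 2 * e <= p * q.
  have [T0|T0] := leP (N2 - M + 2 * e) 0.
    by apply: le_trans T0 _; rewrite mulr_ge0.
  rewrite -(@ler_pXn2r _ 2) ?nnegrE ?mulr_ge0 // ?(ltW T0) //.
  rewrite exprMn pE qE.
  have -> : (K ^+ 2 + A) * (K ^+ 2 + B) =
      ((K ^+ 2 + A + (K ^+ 2 + B)) ^+ 2 - (A - B) ^+ 2) / 4 by lra.
  have -> : K ^+ 2 + A + (K ^+ 2 + B) = 2 * (N2 + M) by rewrite /N2; lra.
  have DM : D * M = N2 * M - e * N2 by rewrite eE /N2; lra.
  rewrite DM in ABd.
  have : 0 <= e * (M - e) by rewrite mulr_ge0 // subr_ge0.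
  nra.
have sum0 : 0 <= p + q by rewrite addr_ge0.
rewrite -(@ler_pXn2r _ 2) ?nnegrE ?mulr_ge0 // exprMn sqr_sqrtr; last by lra.
rewrite (sqrrD p q) pE qE -mulr_natr; move: ABs pq_ge; rewrite /N2; lra.
Qed.

Lemma potential_convex (K D M A B : R) : 0 < K -> 0 <= D -> 0 <= M ->
  0 <= A -> 0 <= B -> A + B = 2 * (D + M) -> (A - B) ^+ 2 <= 16 * (D * M) ->
  2 * Num.sqrt (K ^+ 2 + D) <= Num.sqrt (K ^+ 2 + A) + Num.sqrt (K ^+ 2 + B).
Proof.
move=> K0 D0 M0 A0 B0 ABs ABd.
apply: le_trans (potential_midpoint K0 D0 M0 A0 B0 ABs ABd).
rewrite ler_pM2l // ler_wsqrtr // lerDl.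
by rewrite divr_ge0 ?addr_ge0 ?mulr_ge0 ?exprn_ge0 ?(ltW K0).
Qed.

Lemma gain_sqr (k x : R) : k != 0 ->
  10 * ((2 - x / k) / (10 * k)) * k ^+ 2 = 2 * k - x.
Proof.
move=> k0; have kk : k^-1 * k = 1 by rewrite mulVf.
rewrite invfM.
have -> : 10 * ((2 - x / k) * (10^-1 * k^-1)) * k ^+ 2 =
    2 * k * (k^-1 * k) - x * (k^-1 * k) ^+ 2 by lra.
by rewrite kk expr1n !mulr1.
Qed.

(** A positive gain g forces N < 2K, and then the orthogonal term of [potential_midpoint] is at
    least 1/4. As g <= 1/10 and g N <= 1/5, the square of N + g/2 is at most N^2 + 1/4. *)
Lemma potential_gain (K D M A B : R) : 1 <= K -> 0 <= D -> 1 <= M ->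
  0 <= A -> 0 <= B -> A + B = 2 * (D + M) -> (A - B) ^+ 2 <= 16 * (D * M) ->
  2 * Num.sqrt (K ^+ 2 + D) + (2 - Num.sqrt (K ^+ 2 + D) / K) / (10 * K) <=
    Num.sqrt (K ^+ 2 + A) + Num.sqrt (K ^+ 2 + B).
Proof.
move=> K1 D0 M1 A0 B0 ABs ABd.
have K0 : 0 < K by lra.
have M0 : 0 <= M by lra.
have N20 : 0 <= K ^+ 2 + D by rewrite addr_ge0 // sqr_ge0.
have NE := sqr_sqrtr N20; have N0 := sqrtr_ge0 (K ^+ 2 + D).
have KN : K <= Num.sqrt (K ^+ 2 + D).
  by rewrite -(@ler_pXn2r _ 2) ?nnegrE ?(ltW K0) // NE lerDl.
have [gneg|gpos] := leP ((2 - Num.sqrt (K ^+ 2 + D) / K) / (10 * K)) 0.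
  by apply: le_trans (potential_convex K0 D0 M0 A0 B0 ABs ABd); lra.
apply: le_trans (potential_midpoint K0 D0 M0 A0 B0 ABs ABd).
set N := Num.sqrt (K ^+ 2 + D) in NE N0 KN gpos *.
set g := (2 - N / K) / (10 * K) in gpos *.
have gE : 10 * g * K ^+ 2 = 2 * K - N by rewrite /g gain_sqr ?gt_eqF.
have N2K : N <= 2 * K.
  have : 0 <= 10 * g * K ^+ 2 by rewrite mulr_ge0 ?sqr_ge0 // mulr_ge0 // ltW.
  lra.
have gK : 10 * g * K <= 1.
  rewrite -(ler_pM2r K0); move: gE; rewrite expr2; lra.
have quarter : 4^-1 <= K ^+ 2 * M / (K ^+ 2 + D).
  have N2_gt0 : 0 < K ^+ 2 + D by rewrite ltr_wpDr // exprn_gt0.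
  rewrite ler_pdivlMr // -NE.
  have : N ^+ 2 <= 4 * K ^+ 2.
    have -> : 4 * K ^+ 2 = (2 * K) ^+ 2 by lra.
    by rewrite ler_pXn2r ?nnegrE //; lra.
  have : K ^+ 2 <= K ^+ 2 * M by rewrite ler_peMr // sqr_ge0.
  lra.
have -> : 2 * N + g = 2 * (N + g / 2) by lra.
rewrite ler_pM2l //.
have Ng0 : 0 <= N + g / 2 by lra.
rewrite -(@ler_pXn2r _ 2) ?nnegrE ?sqrtr_ge0 //.
rewrite sqr_sqrtr; last by rewrite addr_ge0 // divr_ge0 // mulr_ge0 // sqr_ge0.
apply: (@le_trans _ _ (K ^+ 2 + D + 4^-1)); last by rewrite lerD2l.
rewrite -NE sqrrD -addrA lerD2l.
have g1 : g <= 10^-1.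
  have : g <= g * K by rewrite ler_peMr // ltW.
  lra.
have gN : g * N <= 5^-1.
  have : g * N <= g * (2 * K) by rewrite ler_wpM2l // ltW.
  lra.
have : g ^+ 2 <= 10^-1 * g by rewrite expr2 ler_wpM2r // ltW.
have -> : N * (g / 2) *+ 2 + (g / 2) ^+ 2 = g * N + g ^+ 2 / 4 by lra.
lra.
Qed.

Definition potential (K L : R) (x y : l2 R) : R :=
  Num.sqrt (K ^+ 2 + sqd x y / L ^+ 2).

(** As a and b are at distance at least 2L, the normalized squared medians sum to at least 2. One of
    them is thus at least 1 and provides the gain, while convexity suffices for the other. *)
Lemma potential_step (K L : R) (s t a b : l2 R) : 1 <= K -> 0 < L ->
  (2 * L) ^+ 2 <= sqd a b ->
  4 * potential K (2 * L) s t + (2 - potential K (2 * L) s t / K) / (10 * K) <=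
  (potential K L s a + potential K L a t) +
  (potential K L s b + potential K L b t).
Proof.
move=> K1 L0 abL; have K0 : 0 < K by lra.
have L20 : 0 < L ^+ 2 by rewrite exprn_gt0.
pose D := sqd s t / (2 * L) ^+ 2.
pose M x := sqn (median x s t) / (2 * L) ^+ 2.
have D0 : 0 <= D by rewrite divr_ge0 ?sqn_ge0 ?sqr_ge0.
have M0 x : 0 <= M x by rewrite divr_ge0 ?sqn_ge0 ?sqr_ge0.
have norm0 x y : 0 <= sqd x y / L ^+ 2 by rewrite divr_ge0 ?sqn_ge0 ?sqr_ge0.
have L2V : ((2 * L) ^+ 2)^-1 = 4^-1 * (L ^+ 2)^-1.
  by rewrite exprMn invfM; congr (_^-1 * _); lra.
have sumE x : sqd s x / L ^+ 2 + sqd x t / L ^+ 2 = 2 * (D + M x).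
  have := congr1 (fun z => z / L ^+ 2) (median_sqd x s t).
  by rewrite /D /M L2V /=; lra.
have diff x : (sqd s x / L ^+ 2 - sqd x t / L ^+ 2) ^+ 2 <= 16 * (D * M x).
  have -> : 16 * (D * M x) = sqd s t * sqn (median x s t) * ((L ^+ 2)^-1) ^+ 2.
    by rewrite /D /M L2V; lra.
  by rewrite -mulrBl exprMn ler_wpM2r ?median_sqd_diff ?sqr_ge0.
have convex x := potential_convex K0 D0 (M0 x) (norm0 s x) (norm0 x t) (sumE x) (diff x).
have gain x M1 := potential_gain K1 D0 M1 (norm0 s x) (norm0 x t) (sumE x) (diff x).
have MM : 2 <= M a + M b.
  rewrite /M -mulrDl ler_pdivlMr; last by rewrite exprn_gt0 // mulr_gt0.
  by apply: le_trans (sqd_le_medians a b s t); lra.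
rewrite /potential -/D.
have [Ma|Ma] := leP 1 (M a).
  have := gain a Ma; have := convex b; lra.
have Mb : 1 <= M b by lra.
have := gain b Mb; have := convex a; lra.
Qed.

End Potential.

(** * Measurability of the potential *)

Section MeasurablePotential.
Context (R : realType) (d : measure_display) (Omega : measurableType d).

Lemma measurable_sqd (f g : Omega -> l2 R) :
  (forall i, measurable_fun [set: Omega]%classic (fun w => f w i : R)) ->
  (forall i, measurable_fun [set: Omega]%classic (fun w => g w i : R)) ->
  measurable_fun [set: Omega]%classic (fun w => sqd (f w) (g w)).
Proof.
move=> mf mg.
have mfg i : measurable_fun [set: Omega]%classic
    (EFin \o (fun w => (f w i - g w i) ^+ 2 : R)).
  apply/measurable_EFinP; apply: measurable_funX.
  by apply: measurable_funB.
have -> : (fun w => sqd (f w) (g w)) = fine \o (fun w => esqn (f w \- g w)).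
  by [].
apply: (measurableT_comp (fine_measurable _)) => //.
apply: (@ge0_emeasurable_sum _ _ _ setT
  (fun i w => ((f w i - g w i) ^+ 2)%:E) xpredT) => [k w _ _|k _]; last exact: mfg.
by rewrite lee_fin sqr_ge0.
Qed.

Lemma measurable_sqrt : measurable_fun [set: R]%classic (@Num.sqrt R).
Proof. by apply: continuous_measurable_fun; exact: sqrt_continuous. Qed.

Lemma measurable_potential (K L : R) (f g : Omega -> l2 R) :
  (forall i, measurable_fun [set: Omega]%classic (fun w => f w i : R)) ->
  (forall i, measurable_fun [set: Omega]%classic (fun w => g w i : R)) ->
  measurable_fun [set: Omega]%classic
    (EFin \o (fun w => potential K L (f w) (g w))).
Proof.
move=> mf mg; apply/measurable_EFinP.
apply: (measurableT_comp measurable_sqrt).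
apply: measurable_funD => //.
apply: measurable_funM => //.
exact: measurable_sqd.
Qed.

End MeasurablePotential.

(** * The adversary and its choice of sides by expected potential *)

Section Adversary.
Context (R : realType) (d : measure_display) (Omega : measurableType d).
Variables (P : probability Omega R) (A : Omega -> online_algorithm R) (m : nat).

Definition pos (l : choice_seq) (i : nat) (w : Omega) : l2 R :=
  A w (\matrix_(a < i.+1, b < i.+1) (vdist m l a b)%:R : 'M[R]_i.+1).

Lemma pos_cat l' l i w : (i < npoints l)%N -> pos (l' ++ l) i w = pos l i w.
Proof.
move=> il; rewrite /pos; congr (A w _); apply/matrixP => a b; rewrite !mxE.
by rewrite vdist_cat //; apply: leq_ltn_trans il; rewrite -ltnS ltn_ord.
Qed.

Definition arrival (l : choice_seq) (i : 'I_#|point_space R l|) :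
  point_space R l := vertex_of_ord (cast_ord (card_space R l) i).

Lemma arrival_bij l : bijective (@arrival l).
Proof.
exists (cast_ord (esym (card_space R l)) \o @ord_of_vertex _) => i.
  by rewrite /= vertex_of_ordK cast_ordK.
by rewrite /arrival /= cast_ordKV ord_of_vertexK.
Qed.

Lemma online_embedding_arrival l i w : size l = m ->
  online_embedding (A w) (@arrival l) i = pos l i w.
Proof.
move=> lm; rewrite /online_embedding /pos; congr (A w _).
by apply/matrixP => a b; rewrite !mxE mdist_space lm.
Qed.

Hypothesis dominatingA : forall l, size l = m ->
  stochastic_dominating P A (@arrival l).

(** Domination is assumed for complete sequences only; it reaches a shorter one through an arbitrary
    completion, on which its points have the same images. *)
Lemma full_extension (l : choice_seq) : (size l <= m)%N ->
  exists l' : choice_seq, size (l' ++ l) = m.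
Proof.
by move=> lm; exists (nseq (m - size l) (true, true)); rewrite size_cat size_nseq subnK.
Qed.

Lemma leq_npoints_cat (l' l : choice_seq) : (npoints l <= npoints (l' ++ l))%N.
Proof. by rewrite /npoints size_cat; lia. Qed.

Lemma ord_arrival l i : (i < npoints l)%N -> (i < #|point_space R l|)%N.
Proof. by rewrite card_space. Qed.

Lemma measurable_pos l i j : (size l <= m)%N -> (i < npoints l)%N ->
  measurable_fun [set: Omega]%classic (fun w => pos l i w j : R).
Proof.
move=> lm il; have [l' l'm] := full_extension lm.
have il' := leq_trans il (leq_npoints_cat l' l).
have [/(_ (Ordinal (ord_arrival il')) j) + _] := dominatingA l'm.
apply: eq_measurable_fun => w _.
by rewrite online_embedding_arrival // pos_cat.
Qed.

Lemma pos_dominating l : (size l <= m)%N ->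
  {ae P, forall w, forall i j, (i < npoints l)%N -> (j < npoints l)%N ->
     (vdist m l i j)%:R ^+ 2 <= sqd (pos l i w) (pos l j w)}.
Proof.
move=> lm; have [l' l'm] := full_extension lm.
have [_ domA] := dominatingA l'm.
apply: filterS domA => w domw i j il jl.
have il' := leq_trans il (leq_npoints_cat l' l).
have jl' := leq_trans jl (leq_npoints_cat l' l).
have := domw (Ordinal (ord_arrival il')) (Ordinal (ord_arrival jl')).
rewrite !online_embedding_arrival // l2distE lee_fin mdist_space l'm /=.
rewrite !pos_cat // vdist_cat // => dom.
rewrite -(@sqr_sqrtr _ (sqd _ _)) ?sqn_ge0 //.
by rewrite ler_pXn2r ?nnegrE // sqrtr_ge0.
Qed.

(** The successor keeps K at least 1 even when m = 0. *)
Local Notation K := (Num.sqrt m.+1%:R : R).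

Definition edge_potential (l : choice_seq) (w : Omega) : R :=
  potential K (edge_len m l)%:R (pos l (ends l).1 w) (pos l (ends l).2 w).

Lemma edge_potential_ge0 l w : 0 <= edge_potential l w.
Proof. exact: sqrtr_ge0. Qed.

Lemma edge_potential_geK l w : K <= edge_potential l w.
Proof.
rewrite /edge_potential /potential.
rewrite ler_sqrt; last by rewrite addr_ge0 ?sqr_ge0 // divr_ge0 ?sqn_ge0 ?sqr_ge0.
by rewrite sqr_sqrtr // lerDl divr_ge0 ?sqn_ge0 ?sqr_ge0.
Qed.

Lemma measurable_edge_potential l : (size l <= m)%N ->
  measurable_fun [set: Omega]%classic (EFin \o edge_potential l).
Proof.
move=> lm; have [s_lt t_lt] := ends_lt l.
by apply: measurable_potential => i; apply: measurable_pos.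
Qed.

Definition mean_potential (l : choice_seq) : \bar R :=
  (\int[P]_w (edge_potential l w)%:E)%E.

Lemma sqdC (x y : l2 R) : sqd x y = sqd y x.
Proof.
rewrite /sqd /sqn /esqn; congr (fine _); apply: eq_eseriesr => i _ /=.
by rewrite -sqrrN opprB.
Qed.

Lemma potentialC (k r : R) (x y : l2 R) : potential k r x y = potential k r y x.
Proof. by rewrite /potential sqdC. Qed.

Lemma K_ge1 : 1 <= K.
Proof. by rewrite -[leLHS]sqrtr1 ler_sqrt // ler1n. Qed.

(** The sides are listed in the order of the sum in [potential_step]. *)
Definition choices : seq (bool * bool) :=
  [:: (true, false); (false, false); (true, true); (false, true)].

Lemma edge_potential_step l : (size l < m)%N ->
  {ae P, forall w, 4 * edge_potential l w + (2 - edge_potential l w / K) / (10 * K)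
    <= \sum_(c <- choices) edge_potential (c :: l) w}.
Proof.
(* The images of the new vertices do not depend on the last choice, so [c0] stands for all four. *)
move=> lm; pose c0 := (true, true).
have [s_lt t_lt] := ends_lt l.
have lm' : (size (c0 :: l) <= m)%N by [].
apply: filterS (pos_dominating lm') => w dom.
pose L : R := (edge_len m (c0 :: l))%:R.
have L0 : 0 < L by rewrite ltr0n edge_len_gt0.
have lenE : (edge_len m l)%:R = 2 * L by rewrite (edge_len_cons c0 lm) -mul2n natrM.
pose f i := pos (c0 :: l) i w.
have := @potential_step R K L (f (ends l).1) (f (ends l).2)
  (f (npoints l)) (f (npoints l).+1) K_ge1 L0.
have -> : potential K (2 * L) (f (ends l).1) (f (ends l).2) = edge_potential l w.
  by rewrite /edge_potential lenE /f -cat1s !pos_cat.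
move=> step; apply: le_trans (step _) _.
  have := dom (npoints l) (npoints l).+1; rewrite vdist_new2 //; last by lia.
  rewrite -mul2n natrM -/L; apply; rewrite npoints_cons; lia.
rewrite !big_cons big_nil addr0 /edge_potential !ends_cons2 !ends_cons1.
rewrite addn0 addn1 -addrA.
rewrite (potentialC K _ (pos _ (ends l).2 w)) (potentialC K _ (pos _ (ends l).2 w)) //.
Qed.

Lemma lte_sum_choices (F : bool * bool -> \bar R) (y : R) :
  (forall c, (F c < y%:E)%E) -> (\sum_(c <- choices) F c < (4 * y)%:E)%E.
Proof.
move=> Fy; have -> : 4 * y = y + (y + (y + y)) by lra.
by rewrite !big_cons big_nil addr0 !EFinD !lteD.
Qed.

Lemma gain_affineE (k x : R) : k != 0 ->
  (4 - (10 * k ^+ 2)^-1) * x + (5 * k)^-1 = 4 * x + (2 - x / k) / (10 * k).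
Proof. by move=> k0; rewrite !invfM; lra. Qed.

Lemma gain_diffE (k x : R) : k != 0 ->
  (2 - x / k) / (10 * k) - 4 * (80 * k)^-1 = (3 / 2 * k - x) / (10 * k ^+ 2).
Proof.
move=> k0; rewrite !invfM.
have : k * k^-1 * k^-1 = k^-1 by rewrite mulfV // mul1r.
by lra.
Qed.

(** If all four sides fell short, so would their sum. For b <= 3K/2 the total gain (2 - b/K) / (10K)
    is at least 1 / (20K), that is 1 / (80K) per side. *)
Lemma mean_potential_step l (b : R) : (size l < m)%N ->
  (b%:E <= mean_potential l)%E -> b <= 3 / 2 * K ->
  exists c, ((b + (80 * K)^-1)%:E <= mean_potential (c :: l))%E.
Proof.
move=> lm b_le bK; have K1 := K_ge1.
apply/not_existsP => small.
have {}small c : (mean_potential (c :: l) < (b + (80 * K)^-1)%:E)%E.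
  by rewrite ltNge; apply/negP/small.
(* With nonnegative coefficients, the affine bound can be integrated even if the mean potential is
   infinite. *)
pose a1 := 4 - (10 * K ^+ 2)^-1; pose a0 := (5 * K)^-1.
have K0 : 0 < K by lra.
have K2 : 1 <= K ^+ 2 by rewrite exprn_ege1.
have a1_ge0 : 0 <= a1.
  have : (10 * K ^+ 2)^-1 <= 1 by rewrite invf_le1; lra.
  rewrite /a1; lra.
have a0_ge0 : 0 <= a0 by rewrite /a0 invr_ge0; lra.
have ep0 l' w : (0 <= (edge_potential l' w)%:E)%E by rewrite lee_fin edge_potential_ge0.
have mep c : measurable_fun [set: Omega]%classic
    (EFin \o edge_potential (c :: l)).
  exact: measurable_edge_potential.
have int_le : (a1%:E * mean_potential l + a0%:E <=
    \sum_(c <- choices) mean_potential (c :: l))%E.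
  rewrite -[X in (_ + X <= _)%E](mule1) -(@probability_setT _ _ _ P).
  rewrite -integral_cst // -ge0_integralZl //; last exact/measurable_edge_potential/ltnW.
  rewrite -ge0_integralD //; last 2 first.
  - by move=> w _; rewrite mule_ge0.
  - by apply: measurable_funeM; exact/measurable_edge_potential/ltnW.
  rewrite -(@ge0_integral_sum _ _ _ P setT measurableT _
    (fun c w => (edge_potential (c :: l) w)%:E) mep (fun c w _ => ep0 _ w)).
  apply: ae_ge0_le_integral => //.
  - by move=> w _; rewrite adde_ge0 // mule_ge0.
  - apply: emeasurable_funD => //.
    by apply: measurable_funeM; exact/measurable_edge_potential/ltnW.
  - by move=> w _; rewrite sume_ge0.
  - by apply: emeasurable_sum => c; exact: mep.
  apply: filterS (edge_potential_step lm) => w + _.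
  rewrite sumEFin /= -EFinM -EFinD lee_fin => potential_le.
  by apply: le_trans potential_le; rewrite /a1 /a0 gain_affineE ?gt_eqF.
have : ((a1 * b + a0)%:E < (4 * (b + (80 * K)^-1))%:E)%E.
  apply: (@le_lt_trans _ _ (\sum_(c <- choices) mean_potential (c :: l))%E).
    apply: le_trans int_le; rewrite EFinD EFinM leeD2r // lee_wpmul2l //.
  exact: lte_sum_choices.
rewrite lte_fin; apply/negP; rewrite -leNgt.
rewrite /a1 /a0 gain_affineE ?gt_eqF // mulrDr lerD2l -subr_ge0.
clear int_le small b_le ep0 mep; rewrite gain_diffE ?gt_eqF // divr_ge0; lra.
Qed.

Lemma mean_potential_growth k : (k <= m)%N -> exists2 l, size l = k
  & ((K + k%:R / (80 * K))%:E <= mean_potential l)%E.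
Proof.
have K1 := K_ge1; have K2 : K ^+ 2 = m.+1%:R by rewrite sqr_sqrtr.
elim: k => [_|k IH km].
  exists [::] => //; rewrite mul0r addr0.
  rewrite -[leLHS]mule1 -(@probability_setT _ _ _ P) -integral_cst //.
  apply: ge0_le_integral => //.
  - by move=> w _; rewrite lee_fin; lra.
  - exact: measurable_edge_potential.
  - by move=> w _; rewrite lee_fin edge_potential_geK.
have [l lk lb] := IH (ltnW km).
(* The choice K^2 = m + 1 keeps the total growth over m steps below K / 80. *)
have bound : K + k%:R / (80 * K) <= 3 / 2 * K.
  have : k%:R / (80 * K) <= K / 80.
    rewrite ler_pdivrMr; last lra.
    have -> : K / 80 * (80 * K) = K ^+ 2 by lra.
    by rewrite K2 ler_nat; lia.
  by clear lb IH; lra.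
have lm : (size l < m)%N by rewrite lk.
have [c cb] := mean_potential_step lm lb bound.
exists (c :: l); first by rewrite /= lk.
by apply: le_trans cb; rewrite lee_fin -(natr1 k) mulrDl mul1r addrA.
Qed.

Lemma expected_distortion_lb : exists2 l, size l = m
  & forall t, expected_distortion P A (@arrival l) t -> m%:R / (80 * K) <= t.
Proof.
have K1 := K_ge1.
have [l lm lb] := mean_potential_growth (leqnn m).
exists l => // t distt.
have [s_lt t_lt] := ends_lt l.
have := distt (Ordinal (ord_arrival s_lt)) (Ordinal (ord_arrival t_lt)).
rewrite mdist_space /= vdist_ends // /edge_len lm subnn mulr1.
under eq_integral do rewrite !online_embedding_arrival // l2distE /=.
move=> le_t.
have msq : measurable_fun [set: Omega]%classic (EFin \o (fun w =>
    Num.sqrt (sqd (pos l (ends l).1 w) (pos l (ends l).2 w)))).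
  apply/measurable_EFinP; apply: (measurableT_comp (@measurable_sqrt R)).
  by apply: measurable_sqd => i; apply: measurable_pos; rewrite ?lm.
(* The last edge has length 1, so t bounds its expected image length, and the potential exceeds that
   length by at most K. *)
have : ((K + m%:R / (80 * K))%:E <= K%:E + t%:E)%E.
  apply: le_trans lb _; apply: (@le_trans _ _ (\int[P]_w (K%:E +
    (Num.sqrt (sqd (pos l (ends l).1 w) (pos l (ends l).2 w)))%:E))%E).
    apply: ge0_le_integral => //.
    - by move=> w _; rewrite lee_fin edge_potential_ge0.
    - by apply: measurable_edge_potential; rewrite lm.
    - exact: emeasurable_funD.
    move=> w _; rewrite -EFinD lee_fin /edge_potential /potential /edge_len lm subnn.
    rewrite expr1n divr1.
    have := sqrtr_ge0 (sqd (pos l (ends l).1 w) (pos l (ends l).2 w)).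
    have sq0 : 0 <= sqd (pos l (ends l).1 w) (pos l (ends l).2 w) by exact: sqn_ge0.
    have := sqr_sqrtr sq0.
    set x := sqd _ _ in sq0 *; set y := Num.sqrt x => yE y0.
    rewrite -(@ler_pXn2r _ 2) ?nnegrE ?sqrtr_ge0 ?addr_ge0 //.
    rewrite sqr_sqrtr ?addr_ge0 ?sqr_ge0 // sqrrD -yE lerD2r lerDl.
    by rewrite mulrn_wge0 // mulr_ge0 // sqrtr_ge0.
  rewrite ge0_integralD //.
  rewrite integral_cst // [X in (_ * X + _)%E](_ : _ = 1%E); last exact: probability_setT.
  by rewrite mule1 leeD2l.
by rewrite -EFinD lee_fin lerD2l.
Qed.

End Adversary.

Theorem theorem1p3 (R : realType) :
  exists (C D : nat) (c : R), 0 < c /\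
  forall n : nat, exists M : set (finMetricType R),
    (forall X : finMetricType R, M X ->
       [/\ (#|X| <= C * n.+1)%N,
           aspect_ratio X = 4 ^+ n,
           ddim_le X D
         & exists (E : {set {set X}}) (w : {set X} -> R),
             [/\ series_parallel_graph E,
                 forall e, e \in E -> 0 < w e
               & shortest_path_metric E w]]) /\
    (forall (d : measure_display) (Omega : measurableType d)
            (P : probability Omega R) (A : Omega -> online_algorithm R),
       (forall X : finMetricType R, M X ->
        forall x : 'I_#|X| -> X, bijective x ->
          stochastic_dominating P A x) ->
       exists2 X : finMetricType R, M X &
       exists2 x : 'I_#|X| -> X, bijective x &
         forall t : R, expected_distortion P A x t ->
           c * Num.sqrt (ln (aspect_ratio X)) <= t /\
           c * Num.sqrt n%:R <= t).
Proof.
(* With 2n steps there are 4n + 2 <= 4 (n + 1) points and the aspect ratio is 2 ^ (2n). The constant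
   1/160 is 1/80, obtained for sqrt n, halved because sqrt (ln (4 ^ n)) <= 2 sqrt n. *)
exists 4%N, 4%N, 160^-1; split=> // n.
have aspectE l : size l = (2 * n)%N -> aspect_ratio (point_space R l) = 4 ^+ n.
  by move=> ln2; rewrite aspect_ratio_space ln2 exprM; congr (_ ^+ n); lra.
exists (fun X => exists2 l, size l = (2 * n)%N & X = point_space R l); split.
  move=> _ [l ln2 ->]; split.
  - by rewrite card_space /npoints ln2; lia.
  - exact: aspectE.
  - exact: ddim_space.
  - exact: space_shortest_path.
move=> d Omega P A domA.
have dom l : size l = (2 * n)%N -> stochastic_dominating P A (@arrival R l).
  by move=> ln2; apply: domA (arrival_bij R l); exists l.
have [l ln2 lb] := expected_distortion_lb dom.
exists (point_space R l); first by exists l.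
exists (@arrival R l); first exact: arrival_bij.
move=> t /lb; set k := Num.sqrt (2 * n).+1%:R => le_t.
have k2 : k ^+ 2 = 2 * n%:R + 1 by rewrite sqr_sqrtr // -natr1 natrM.
have k1 : 1 <= k by exact: K_ge1.
have n0 : 0 <= n%:R :> R by [].
have r0 := sqrtr_ge0 (n%:R : R); have r2 := sqr_sqrtr n0.
set r := Num.sqrt n%:R in r0 r2 *.
(* The squares compare as n (2n + 1) <= 4 n^2, which needs n >= 1 or n = 0. *)
have rk : r * k <= 2 * n%:R.
  rewrite -(@ler_pXn2r _ 2) ?nnegrE ?mulr_ge0 //; last lra.
  rewrite exprMn r2 k2.
  have [->|ngt0] := posnP n; first by rewrite !mul0r mulr0 expr0n.
  have : 1 <= n%:R :> R by rewrite ler1n.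
  by nra.
have rt : r / 80 <= t.
  apply: le_trans le_t; rewrite natrM ler_pdivlMr; last lra.
  have -> : r / 80 * (80 * k) = r * k by lra.
  exact: rk.
split; last by apply: le_trans rt; rewrite mulrC; lra.
rewrite (aspectE l ln2) lnXn; last by [].
have ln4 : ln (4 : R) <= 4 by apply/ltW/ln_sublinear.
have : Num.sqrt (ln (4 : R) *+ n) <= 2 * r.
  rewrite -(@ler_pXn2r _ 2) ?nnegrE ?sqrtr_ge0 ?mulr_ge0 //.
  rewrite sqr_sqrtr; last by rewrite mulrn_wge0 // ln_ge0 // ler1n.
  by rewrite exprMn r2 -(mulr_natr (ln 4)) ler_wpM2r //; lra.
lra.
Qed.
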